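(* Let $\mathbf{F}$ be a Fraïssé structure in $L$ and let $\mathbf{F}^{*}$ be a Fraïssé precompact expansion of $\mathbf{F}$ in $L^{*}$ whose age consists of rigid structures. Assume that the pair $(\mathrm{Age}(\mathbf{F}),\mathrm{Age}(\mathbf{F}^{*}))$ has the relative Ramsey property for structures and that $\mathrm{Age}(\mathbf{F}^{*})$ has the expansion property relative to $\mathrm{Age}(\mathbf{F})$. Then $\mathrm{Age}(\mathbf{F}^{*})$ has the Ramsey property.
   Context: $\mathbb{N}=\{0,1,2,\ldots\}$ and $[k]=\{0,\ldots,k-1\}$. $L$ is a countable first-order signature and $L^{*}=L\cup\{R_i : i\in I^{*}\}$, where $I^{*}$ is countable and each $R_i$ is a relation symbol not in $L$. A Fraïssé structure is a countable (infinite), locally finite (finitely generated substructures are finite), ultrahomogeneous structure (every isomorphism between finite substructures extends to an automorphism). $\mathrm{Age}(\mathbf{F})$ is the class of finite structures that embed in $\mathbf{F}$. An expansion $\mathbf{F}^{*}$ of $\mathbf{F}$ in $L^{*}$ is an $L^{*}$-structure whose $L$-reduct is $\mathbf{F}$; ''Fraïssé expansion'' means $\mathbf{F}^{*}$ is itself a Fraïssé structure in $L^{*}$. It is precompact if every element of $\mathrm{Age}(\mathbf{F})$ has only finitely many expansions in $\mathrm{Age}(\mathbf{F}^{*})$. Both have universe $\mathbb{N}$. A structure is rigid if its only automorphism is the identity. A class $\mathcal{K}^{*}$ of $L^{*}$-structures is an expansion in $L^{*}$ of a class $\mathcal{K}$ of $L$-structures if every element of $\mathcal{K}^{*}$ is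 an expansion of an element of $\mathcal{K}$ and every element of $\mathcal{K}$ has an expansion in $\mathcal{K}^{*}$. For $\mathbf{B}^{*}\in\mathcal{K}^{*}$, $\mathbf{B}$ denotes its $L$-reduct. $\binom{\mathbf{B}}{\mathbf{A}}$ is the set of substructures of $\mathbf{B}$ isomorphic to $\mathbf{A}$ (copies of $\mathbf{A}$), and $\binom{\mathbf{B}}{\mathbf{A}}_{\mathrm{Emb}}$ is the set of embeddings of $\mathbf{A}$ into $\mathbf{B}$. For $\widetilde{\mathbf{A}}_0,\widetilde{\mathbf{A}}_1\in\binom{\mathbf{B}}{\mathbf{A}}$ with universes $\tilde A_0,\tilde A_1$, write $\widetilde{\mathbf{A}}_0\cong_{\mathbf{B}^{*}}\widetilde{\mathbf{A}}_1$ if the substructures $\mathbf{B}^{*}\upharpoonright\tilde A_0$ and $\mathbf{B}^{*}\upharpoonright\tilde A_1$ of $\mathbf{B}^{*}$ are isomorphic. For $\mathcal{K}$ a class of finite $L$-structures and $\mathcal{K}^{*}$ an expansion of $\mathcal{K}$ in $L^{*}$, the pair $(\mathcal{K},\mathcal{K}^{*})$ has the relative Ramsey property for structures if for every $k\in\mathbb{N}$, $\mathbf{A}\in\mathcal{K}$, $\mathbf{B}^{*}\in\mathcal{K}^{*}$, there exists $\mathbf{C}\in\mathcal{K}$ such that for every coloring $c:\binom{\mathbf{C}}{\mathbf{A}}\to[k]$ there exists $b\in\binom{\mathbf{C}}{\mathbf{B}}_{\mathrm{Emb}}$ such that for all $\widetilde{\mathbf{A}}_0,\widetilde{\mathbf{A}}_1\in\binom{\mathbf{B}}{\mathbf{A}}$,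 $\widetilde{\mathbf{A}}_0\cong_{\mathbf{B}^{*}}\widetilde{\mathbf{A}}_1$ implies $c(b(\widetilde{\mathbf{A}}_0))=c(b(\widetilde{\mathbf{A}}_1))$. An expansion $\mathcal{K}^{*}$ of $\mathcal{K}$ has the expansion property relative to $\mathcal{K}$ if for every $\mathbf{A}\in\mathcal{K}$ there exists $\mathbf{B}\in\mathcal{K}$ such that for all $\mathbf{A}^{*},\mathbf{B}^{*}\in\mathcal{K}^{*}$ with $L$-reducts $\mathbf{A}$ and $\mathbf{B}$ respectively, $\mathbf{A}^{*}$ embeds in $\mathbf{B}^{*}$. A class $\mathcal{C}$ of finite structures has the Ramsey property if for every $k\in\mathbb{N}$ and $\mathbf{A},\mathbf{B}\in\mathcal{C}$ there exists $\mathbf{C}\in\mathcal{C}$ such that for every $c:\binom{\mathbf{C}}{\mathbf{A}}\to[k]$ there is $\widetilde{\mathbf{B}}\in\binom{\mathbf{C}}{\mathbf{B}}$ such that $c$ takes at most one value on $\binom{\widetilde{\mathbf{B}}}{\mathbf{A}}$. *)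

(* Defs.v *)
From HB Require Import structures.
From mathcomp Require Import all_boot.
From mathcomp Require Import boolp classical_sets functions cardinality.

Set Implicit Arguments.
Unset Strict Implicit.
Unset Printing Implicit Defensive.

Local Open Scope classical_set_scope.

(** Countable signatures; constants are the function symbols of arity 0. *)
Record signature := Signature {
  fsym : countType;
  rsym : countType;
  far : fsym -> nat;
  rar : rsym -> nat
}.

Record structure (L : signature) (T : Type) := Struct {
  fint : forall f : fsym L, ('I_(far f) -> T) -> T;
  rint : forall r : rsym L, ('I_(rar r) -> T) -> Prop
}.

(** [L] together with new relation symbols [R_i], [i : I], of arity [ar i]. *)
Definition add_rels (L : signature) (I : countType) (ar : I -> nat) :
    signature :=
  @Signature (fsym L) (rsym L + I)%type (@far L)
    (fun s => match s with inl r => rar r | inr i => ar i end).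

Definition reduct (L : signature) (I : countType) (ar : I -> nat) (T : Type)
    (A : structure (add_rels L ar) T) : structure L T :=
  @Struct L T (@fint _ _ A) (fun r => @rint _ _ A (inl r)).

Section Structures.
Context {L : signature}.

Definition embedding (S T : Type) (A : structure L S) (B : structure L T)
    (h : S -> T) : Prop :=
  [/\ injective h,
      forall f (x : 'I_(far f) -> S), h (fint A x) = fint B (h \o x) &
      forall r (x : 'I_(rar r) -> S), rint A x <-> rint B (h \o x)].

Definition isomorphism (S T : Type) (A : structure L S) (B : structure L T)
    (h : S -> T) : Prop :=
  embedding A B h /\ bijective h.

Definition isomorphic (S T : Type) (A : structure L S) (B : structure L T) :
    Prop :=
  exists h : S -> T, isomorphism A B h.

Definition rigid (T : Type) (A : structure L T) : Prop :=
  forall h : T -> T, isomorphism A A h -> h =1 id.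

(** The universes of the substructures of [B]. The empty set qualifies when
    [L] has no constants. *)
Definition fclosed (T : Type) (B : structure L T) (X : set T) : Prop :=
  forall f (x : 'I_(far f) -> T), (forall i, X (x i)) -> X (fint B x).

Lemma fclosed_val (T : Type) (B : structure L T) (X : set T)
    (hX : fclosed B X) f (x : 'I_(far f) -> X) :
  fint B (fun i => val (x i)) \in X.
Proof. by apply/mem_set/hX => i; apply/set_mem/valP. Qed.

(** The substructure of [B] with universe [X]. *)
Definition induced (T : Type) (B : structure L T) (X : set T)
    (hX : fclosed B X) : structure L X :=
  @Struct L X
    (fun f x => Sub (fint B (fun i => val (x i))) (fclosed_val hX x))
    (fun r x => rint B (fun i => val (x i))).

(** The copies of [A] in [B]; a substructure is given by its universe. *)
Definition copies (S T : Type) (A : structure L S) (B : structure L T) :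
    set (set T) :=
  [set X | exists hX : fclosed B X, isomorphic A (induced hX)].

Definition iso_in (T : Type) (B : structure L T) (X Y : set T) : Prop :=
  exists (hX : fclosed B X) (hY : fclosed B Y),
    isomorphic (induced hX) (induced hY).

Definition locally_finite (T : Type) (F : structure L T) : Prop :=
  forall S : set T, finite_set S -> finite_set (smallest (fclosed F) S).

Definition ultrahomogeneous (T : Type) (F : structure L T) : Prop :=
  forall (X Y : set T) (hX : fclosed F X) (hY : fclosed F Y) (g : X -> Y),
    finite_set X -> finite_set Y ->
    isomorphism (induced hX) (induced hY) g ->
    exists2 h : T -> T, isomorphism F F h &
      forall x : X, h (val x) = val (g x).

Definition fraisse (T : Type) (F : structure L T) : Prop :=
  [/\ countable [set: T], infinite_set [set: T],
      locally_finite F & ultrahomogeneous F].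

End Structures.

Definition fin_class (L : signature) : Type :=
  forall T : finType, structure L T -> Prop.

Definition age (L : signature) (U : Type) (F : structure L U) : fin_class L :=
  fun T A => exists h : T -> U, embedding A F h.

(** A [k]-coloring of the copies of [A] in [C] is a total map on subsets of [C]
    required to take values below [k] on copies only, so that [k = 0] is not
    degenerate when there are no copies. The copies of [A] in the substructure
    with universe [Y] are the copies of [A] in [C] contained in [Y]. *)
Definition ramsey (L : signature) (K : fin_class L) : Prop :=
  forall (k : nat) (S T : finType) (A : structure L S) (B : structure L T),
    K S A -> K T B ->
    exists (U : finType) (C : structure L U), K U C /\
      forall c : set U -> nat, set_fun (copies A C) `I_k c ->
      exists2 Y : set U, copies B C Y &
        forall X0 X1 : set U,
          copies A C X0 -> X0 `<=` Y -> copies A C X1 -> X1 `<=` Y ->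
          c X0 = c X1.

Section Expansions.
Context {L : signature} {I : countType} {ar : I -> nat}.
Local Notation Ls := (add_rels L ar).

Definition precompact (U : Type) (F : structure L U) (Fs : structure Ls U) :
    Prop :=
  forall (T : finType) (A : structure L T), age F A ->
    finite_set [set As : structure Ls T | age Fs As /\ reduct As = A].

Definition class_expansion (K : fin_class L) (Ks : fin_class Ls) : Prop :=
  (forall (T : finType) (As : structure Ls T), Ks T As -> K T (reduct As)) /\
  (forall (T : finType) (A : structure L T), K T A ->
     exists2 As : structure Ls T, Ks T As & reduct As = A).

(** The two properties below are meant for an expansion [Ks] of [K], which ages
    of an expansion always are. *)
Lemma age_expansion (U : Type) (F : structure L U) (Fs : structure Ls U) :
  reduct Fs = F -> class_expansion (age F) (age Fs).
Proof.
move=> <-; split=> T.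
  by move=> As [h [hi hf hr]]; exists h; split=> // r x; apply: (hr (inl r)).
move=> A [h [hi hf hr]].
exists (@Struct Ls T (@fint _ _ A) (fun r x => rint Fs (h \o x))).
  by exists h; split.
case: A hf hr => af ar' hf hr; congr Struct.
apply: functional_extensionality_dep => r; apply: funext => x.
by apply/propext; split=> /hr.
Qed.

Definition relative_ramsey (K : fin_class L) (Ks : fin_class Ls) : Prop :=
  forall (k : nat) (S T : finType) (A : structure L S) (Bs : structure Ls T),
    K S A -> Ks T Bs ->
    exists (U : finType) (C : structure L U), K U C /\
      forall c : set U -> nat, set_fun (copies A C) `I_k c ->
      exists2 b : T -> U, embedding (reduct Bs) C b &
        forall X0 X1 : set T,
          copies A (reduct Bs) X0 -> copies A (reduct Bs) X1 ->
          iso_in Bs X0 X1 -> c (b @` X0) = c (b @` X1).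

Definition expansion_property (K : fin_class L) (Ks : fin_class Ls) : Prop :=
  forall (S : finType) (A : structure L S), K S A ->
    exists (T : finType) (B : structure L T), K T B /\
      forall (As : structure Ls S) (Bs : structure Ls T),
        Ks S As -> Ks T Bs -> reduct As = A -> reduct Bs = B ->
        exists h : S -> T, embedding As Bs h.

End Expansions.

(* Main.v *)
Require Import Defs.
From HB Require Import structures.
From mathcomp Require Import all_boot.
From mathcomp Require Import boolp classical_sets functions cardinality.

Set Implicit Arguments.
Unset Strict Implicit.
Unset Printing Implicit Defensive.

(** Write [A], [B] for the [L]-reducts of the members [As], [Bs] of the age of
    [Fs]; below, an expansion is always one that belongs to this age. The
    expansion property gives [D] such that [Bs] embeds in every expansion of
    [D]. Each expansion [Ds] of [D] partitions the copies of [A] in [D] by the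
    isomorphism type that they have in [Ds]; as [D] is finite, there is a [Ds]
    for which this equivalence relation is maximal under inclusion
    ([exists_maximal_expansion]). Let [C] be given by the relative Ramsey
    property for [A] and [Ds], and let [Cs] be any expansion of [C].

    A coloring [c] of the copies of [As] in [Cs] is turned into a coloring of
    the copies of [A] in [C] that records both [c] and the isomorphism type in
    [Cs]; by precompactness the number of its colors is bounded independently
    of [C]. This yields an embedding [b] of [D] in [C]. Let [Ds'] be the
    expansion of [D] pulled back from [Cs] along [b] ([pull_expansion]). Copies
    of [A] that are isomorphic in [Ds] have the same color, hence are isomorphic
    in [Ds']. By maximality, conversely, copies that are isomorphic in [Ds'] are
    isomorphic in [Ds], so they have the same color. In particular the copies of
    [As] in [Ds'] all have the same color; since [Bs] embeds in [Ds'], its image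
    under [b] is the required monochromatic copy of [Bs] in [Cs]. *)

Local Open Scope classical_set_scope.

(** * Embeddings and copies *)

Section Embeddings.
Context {L : signature}.

Lemma embedding_comp (S T U : Type) (A : structure L S) (B : structure L T)
    (C : structure L U) (h : S -> T) (g : T -> U) :
  embedding A B h -> embedding B C g -> embedding A C (g \o h).
Proof.
move=> [hi hf hr] [gi gf gr]; split.
- exact: inj_comp.
- by move=> f x /=; rewrite hf gf.
- by move=> r x; rewrite hr gr.
Qed.

Lemma isomorphic_sym (S T : Type) (A : structure L S) (B : structure L T) :
  isomorphic A B -> isomorphic B A.
Proof.
move=> [h [[hi hf hr] [g hK gK]]]; exists g.
have comp_gK U (x : U -> T) : h \o (g \o x) = x by apply: funext => i /=.
split; last by exists h.
split; first exact: can_inj gK.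
- by move=> f x; rewrite -{1}(comp_gK _ x) -hf hK.
- by move=> r x; rewrite hr comp_gK.
Qed.

Lemma isomorphic_trans (S T U : Type) (A : structure L S) (B : structure L T)
    (C : structure L U) :
  isomorphic A B -> isomorphic B C -> isomorphic A C.
Proof.
move=> [h [eh bh]] [g [eg bg]]; exists (g \o h); split.
  exact: embedding_comp eh eg.
exact: bij_comp.
Qed.

Lemma induced_embedding (T : Type) (B : structure L T) (X : set T)
    (hX : Defs.fclosed B X) : embedding (induced hX) B val.
Proof. by split=> //; exact: val_inj. Qed.

Lemma fclosed_range (S T : Type) (A : structure L S) (B : structure L T)
    (h : S -> T) : embedding A B h -> Defs.fclosed B (range h).
Proof.
move=> [_ hf _] f x hx.
have [y yx] : exists y : 'I_(far f) -> S, h \o y = x.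
  have pre i : {s | h s = x i} by apply: cid; case: (hx i) => s _ <-; exists s.
  by exists (fun i => sval (pre i)); apply: funext => i /=; case: (pre i).
by exists (fint A y) => //; rewrite hf yx.
Qed.

Lemma isomorphic_range (S T : Type) (A : structure L S) (B : structure L T)
    (h : S -> T) (hX : Defs.fclosed B (range h)) :
  embedding A B h -> isomorphic A (induced hX).
Proof.
move=> [hi hf hr].
have mh s : h s \in range h by apply: mem_set; exists s.
pose g s : range h := Sub (h s) (mh s).
exists g; split; first split.
- by move=> s t /(congr1 val); apply: hi.
- by move=> f x; apply: val_inj; rewrite /= hf.
- by move=> r x; rewrite hr.
have pre (y : range h) : {s | h s = val y}.
  by apply: cid; have /set_mem[s _ sy] := valP y; exists s.
exists (fun y => sval (pre y)) => [s|y].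
  by case: (pre (g s)) => t /= /hi.
by apply: val_inj => /=; case: (pre y).
Qed.

(** The copies of [A] are the ranges of its embeddings. *)
Lemma copiesP (S T : Type) (A : structure L S) (B : structure L T)
    (X : set T) :
  copies A B X <-> exists2 h : S -> T, embedding A B h & range h = X.
Proof.
split=> [[hX [h [eh [g _ gK]]]]|[h eh <-]].
  exists (val \o h); first exact: embedding_comp eh (induced_embedding hX).
  apply/seteqP; split=> [_ [s _ <-]|x Xx]; first exact/set_mem/valP.
  exists (g (Sub x (mem_set Xx))) => //=.
  by rewrite gK.
exists (fclosed_range eh); exact: isomorphic_range.
Qed.

Lemma copies_iso_in (S T : Type) (A : structure L S) (B : structure L T)
    (X Y : set T) : copies A B X -> copies A B Y -> iso_in B X Y.
Proof.
move=> [hX iX] [hY iY]; exists hX, hY.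
exact: isomorphic_trans (isomorphic_sym iX) iY.
Qed.

Lemma copies_image (S T U : Type) (A : structure L S) (B : structure L T)
    (C : structure L U) (b : T -> U) (X : set T) :
  embedding B C b -> copies A B X -> copies A C (b @` X).
Proof.
move=> eb /copiesP[h eh <-]; apply/copiesP; exists (b \o h).
  exact: embedding_comp eh eb.
by rewrite image_comp.
Qed.

(** A copy of [A] in [C] that lies in an embedded [B] is the image of a copy of
    [A] in [B]. *)
Lemma copies_preimage (S T U : Type) (A : structure L S) (B : structure L T)
    (C : structure L U) (b : T -> U) (X : set U) :
  embedding B C b -> copies A C X -> X `<=` range b ->
  exists2 Z : set T, copies A B Z & b @` Z = X.
Proof.
move=> [bi bf br] /copiesP[h [hi hf hr] <-] sub.
have pre s : {t | b t = h s}.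
  by apply: cid; have [|t _ bt] := sub (h s); [exists s|exists t].
pose g s := sval (pre s).
have bg s : b (g s) = h s by rewrite /g; case: (pre s).
have bgE : b \o g = h by apply: funext.
exists (range g); last by rewrite image_comp bgE.
apply/copiesP; exists g => //; split.
- by move=> s t gst; apply: hi; rewrite -!bg gst.
- by move=> f x; apply: bi; rewrite bg hf bf -bgE.
- by move=> r x; rewrite hr br -bgE.
Qed.

Lemma copies_of_image (S T U : Type) (A : structure L S) (B : structure L T)
    (C : structure L U) (b : T -> U) (X : set T) :
  embedding B C b -> copies A C (b @` X) -> copies A B X.
Proof.
move=> eb cX; have [_ [x _ <-]|Z cZ bZ] := copies_preimage eb cX.
  by exists x.
have [bi _ _] := eb.
suff <- : Z = X by [].
by apply: funext => x; rewrite -(image_inj bi) bZ image_inj.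
Qed.

Lemma age_embedding (U : Type) (F : structure L U) (S T : finType)
    (A : structure L S) (B : structure L T) (h : S -> T) :
  embedding A B h -> age F B -> age F A.
Proof. by move=> eh [g eg]; exists (g \o h); exact: embedding_comp eh eg. Qed.

End Embeddings.

(** * Reducts and expansions *)

Section Reducts.
Context {L : signature} {I : countType} {ar : I -> nat}.
Local Notation Ls := (add_rels L ar).

Lemma reduct_embedding (S T : Type) (As : structure Ls S)
    (Bs : structure Ls T) (h : S -> T) :
  embedding As Bs h -> embedding (reduct As) (reduct Bs) h.
Proof. by move=> [hi hf hr]; split=> // r x; apply: (hr (inl r)). Qed.

Lemma copies_reduct (S T : Type) (As : structure Ls S) (Bs : structure Ls T)
    (X : set T) : copies As Bs X -> copies (reduct As) (reduct Bs) X.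
Proof.
move=> /copiesP[h eh <-]; apply/copiesP; exists h => //.
exact: reduct_embedding.
Qed.

(** An embedding of [A] in the reduct of [Bs] pulls [Bs] back to an expansion
    of [A]. *)
Lemma pull_expansion (S T : Type) (A : structure L S) (Bs : structure Ls T)
    (h : S -> T) :
  embedding A (reduct Bs) h ->
  exists2 As : structure Ls S, reduct As = A & embedding As Bs h.
Proof.
move=> [hi hf hr].
exists (@Struct Ls S (@fint _ _ A) (fun r x => rint Bs (h \o x))); last by split.
case: A hf hr => af rel hf hr; congr Struct.
apply: functional_extensionality_dep => r; apply: funext => x.
by apply/propext; split=> /hr.
Qed.

End Reducts.

(** * Expansions with a maximal isomorphism relation *)

Lemma exists_maximal_image (J : Type) (E : finType) (P : J -> Prop)
    (m : J -> {set E}) :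
  (exists j, P j) ->
  exists2 j, P j & forall j', P j' -> m j \subset m j' -> m j' = m j.
Proof.
move=> [j0 Pj0].
pose Q (s : {set E}) := `[< exists2 j, P j & m j = s >].
have [|_ /maxsetP[/asboolP[j Pj <-] maxj] _] := @maxset_exists E Q (m j0).
  by apply/asboolP; exists j0.
by exists j => // j' Pj'; apply: maxj; apply/asboolP; exists j'.
Qed.

Section MaximalExpansion.
Context {L : signature} {I : countType} {ar : I -> nat}.
Local Notation Ls := (add_rels L ar).

(** Among the expansions of [D] in a class, there is one whose isomorphism
    relation on the copies of [A] in [D] is not properly contained in that of
    another. *)
Lemma exists_maximal_expansion (Ks : fin_class Ls) (S T : finType)
    (A : structure L S) (D : structure L T) :
  (exists2 Ds : structure Ls T, Ks T Ds & reduct Ds = D) ->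
  exists Ds : structure Ls T, [/\ Ks T Ds, reduct Ds = D &
    forall Ds' : structure Ls T, Ks T Ds' -> reduct Ds' = D ->
      (forall X0 X1, copies A D X0 -> copies A D X1 ->
         iso_in Ds X0 X1 -> iso_in Ds' X0 X1) ->
      forall X0 X1, copies A D X0 -> copies A D X1 ->
         iso_in Ds' X0 X1 -> iso_in Ds X0 X1].
Proof.
move=> [D0 KD0 rD0].
pose R (Ds : structure Ls T) (X : set T * set T) :=
  [/\ copies A D X.1, copies A D X.2 & iso_in Ds X.1 X.2].
pose m Ds : {set {set T} * {set T}} :=
  finset (fun p : {set T} * {set T} => `[< R Ds ([set` p.1], [set` p.2]) >]).
have [|Ds [KDs rDs] maxDs] := @exists_maximal_image _ _
    (fun Ds : structure Ls T => Ks T Ds /\ reduct Ds = D) m.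
  by exists D0.
exists Ds; split=> // Ds' KDs' rDs' sub X0 X1 cX0 cX1 iso'.
have mE : m Ds' = m Ds.
  apply: maxDs => //; apply/fintype.subsetP => p; rewrite !finset.inE => /asboolP r.
  by apply/asboolP; case: r => c0 c1 i01; split=> //; apply: sub.
pose fs (X : set T) : {set T} := finset (fun x => x \in X).
have fsE X : [set` fs X] = X.
  by apply/seteqP; split=> x /=; rewrite inE in_setE.
have : (fs X0, fs X1) \in m Ds'.
  by rewrite inE; apply/asboolP; rewrite !fsE.
by rewrite mE inE => /asboolP; rewrite !fsE => -[].
Qed.

End MaximalExpansion.

(** * The Ramsey property *)

Theorem theorem3 (L : signature) (I : countType) (ar : I -> nat)
    (F : structure L nat) (Fs : structure (add_rels L ar) nat) :
  fraisse F -> fraisse Fs -> reduct Fs = F -> precompact F Fs ->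
  (forall (T : finType) (A : structure (add_rels L ar) T),
     age Fs A -> rigid A) ->
  relative_ramsey (age F) (age Fs) ->
  expansion_property (age F) (age Fs) ->
  ramsey (age Fs).
Proof.
move=> _ _ rF preF _ relR expP k S T As Bs KAs KBs.
have [Kred Kexp] := age_expansion rF.
pose A := reduct As; have KA : age F A by apply: Kred.
have [V [D [KD DP]]] := expP _ _ (Kred _ _ KBs).
have [Ds [KDs rDs maxDs]] := exists_maximal_expansion A (Kexp _ _ KD).
have /finite_setP[n /card_set_bijP[idx [idx_lt idx_inj _]]] := preF _ _ KA.
have [U [C [KC CP]]] := relR (n * k.+1)%N _ _ _ _ KA KDs.
have [Cs KCs rCs] := Kexp _ _ KC.
exists U, Cs; split=> // c cP.
(* [ty X] is an expansion of [A] isomorphic to the substructure of [Cs] with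
   universe [X]. *)
have tyP (X : set U) : exists E : structure (add_rels L ar) S,
    copies A C X -> [/\ age Fs E, reduct E = A & copies E Cs X].
  have [/copiesP[h eh hX]|nX] := pselect (copies A C X); last by exists As.
  rewrite -rCs in eh; have [E rE eE] := pull_expansion eh.
  exists E => _; split=> //; first exact: age_embedding eE KCs.
  by apply/copiesP; exists h.
have [ty {}tyP] := choice tyP.
(* The value [k] marks the copies of [A] that are not copies of [As]. *)
pose d X := if `[< copies As Cs X >] then c X else k.
have d_lt X : (d X < k.+1)%N.
  by rewrite /d; case: asboolP => // /cP /= /ltnW; rewrite ltnS.
(* The pair of the index of [ty X], below [n], and of [d X], below [k.+1], is
   encoded as a number below [n * k.+1]. *)
pose col X := (idx (ty X) * k.+1 + d X)%N.
have col_inj X Y : col X = col Y -> idx (ty X) = idx (ty Y) /\ d X = d Y.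
  move=> e; split.
    by have /(congr1 (divn^~ k.+1)) := e; rewrite !divnMDl // !divn_small ?addn0.
  by have /(congr1 (modn^~ k.+1)) := e; rewrite !modnMDl !modn_small.
have [|b eb colb] := CP col.
  move=> X /tyP[aE rE _].
  have /= lt_n : `I_n (idx (ty X)) by apply: idx_lt.
  apply: (@leq_trans ((idx (ty X)).+1 * k.+1)%N); last first.
    by rewrite leq_mul2r lt_n orbT.
  by rewrite /col mulSn addnC ltn_add2r.
rewrite rDs in eb colb; rewrite -rCs in eb.
have [Ds' rDs' eb'] := pull_expansion eb.
have KDs' : age Fs Ds' by apply: age_embedding eb' KCs.
have bC X : copies A D X -> copies A C (b @` X).
  by rewrite -rCs; apply: copies_image.
have iso' X0 X1 : copies A D X0 -> copies A D X1 ->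
    iso_in Ds X0 X1 -> iso_in Ds' X0 X1.
  move=> c0 c1 i01; have [eidx _] := col_inj _ _ (colb _ _ c0 c1 i01).
  have [a0 r0 t0] := tyP _ (bC _ c0); have [a1 r1 t1] := tyP _ (bC _ c1).
  have ety : ty (b @` X0) = ty (b @` X1).
    by apply: idx_inj eidx; apply: mem_set.
  rewrite ety in t0.
  exact: copies_iso_in (copies_of_image eb' t0) (copies_of_image eb' t1).
have isoD := maxDs _ KDs' rDs' iso'.
have [h eh] := DP Bs Ds' KBs KDs' erefl rDs'.
have ebh := embedding_comp eh eb'.
exists (range (b \o h)); first by apply/copiesP; exists (b \o h).
have pre X : copies As Cs X -> X `<=` range (b \o h) ->
    exists2 Z, copies As Ds' Z & b @` Z = X.
  move=> cX sX; apply: copies_preimage eb' cX _.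
  by move=> x /sX[t _ <-]; exists (h t).
move=> X0 X1 c0 s0 c1 s1.
have [Z0 z0 e0] := pre _ c0 s0; have [Z1 z1 e1] := pre _ c1 s1.
have cA0 : copies A D Z0 by rewrite -rDs'; apply: copies_reduct.
have cA1 : copies A D Z1 by rewrite -rDs'; apply: copies_reduct.
have iZ := isoD _ _ cA0 cA1 (copies_iso_in z0 z1).
have [_] := col_inj _ _ (colb _ _ cA0 cA1 iZ).
by rewrite e0 e1 /d; case: asboolP => // _; case: asboolP.
Qed.
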